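(* Let $N\ge 1$ and let $\Omega=\Omega^{(L)}\cup\Omega^{(R)}$ be a planar two-patch domain described by an analysis-suitable $G^1$ two-patch geometry $\mathbf F$. For $\ell=0,\dots,N-1$ let $$\Phi^\ell=\Phi^\ell_{\Omega^{(L)}}\cup\Phi^\ell_{\Omega^{(R)}}\cup\Phi^\ell_{\Gamma_0}\cup\Phi^\ell_{\Gamma_1}$$ be the set of $C^1$ isogeometric basis functions of level $\ell$ on $\Omega$, constructed on dyadically refined knot vectors as described in the context. Then, for every $\ell=0,\dots,N-1$, the set $\Phi^\ell$ is locally linearly independent; that is, for any open set $\widetilde\Omega\subset\Omega$, the functions of $\Phi^\ell$ that do not vanish (identically) on $\widetilde\Omega$ are linearly independent on $\widetilde\Omega$.
   Context: Univariate splines. Let $k,p,r$ be positive integers with $p\ge 3$ and $1\le r\le p-2$, and let $0<\tau_1<\tau_2<\dots<\tau_k<1$ be internal breakpoints. Level $0$ uses these breakpoints: $k^0=k$, $\tau_i^0=\tau_i$. For $\ell\ge 1$, the breakpoints $\tau_1^\ell<\dots<\tau_{k^\ell}^\ell$ of level $\ell$ are obtained from those of level $\ell-1$ by dyadic refinement (adding the midpoint of every knot span of $[0,1]$), so $k^\ell=2k^{\ell-1}+1$. Let $\mathbb S_p^{r,\ell}$ be the space of splines on $[0,1]$ of degree $p$ with respect to the open knot vector in which $0$ and $1$ have multiplicity $p+1$ and each internal breakpoint $\tau_i^\ell$ has multiplicity $p-r$ (so the splines are $C^r$); its B-splines are $N_{i,p}^{r,\ell}$, $i\in\mathbf I^\ell=\{0,\dots,n^\ell-1\}$,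 $n^\ell=p+1+k^\ell(p-r)$. Let $\mathbb S_p^{r+1,\ell}$ (degree $p$, regularity $r+1$) and $\mathbb S_{p-1}^{r,\ell}$ (degree $p-1$, regularity $r$) be the analogous spaces with the same internal breakpoints, with B-splines $N_{i,p}^{r+1,\ell}$, $i\in\mathbf I_0^\ell=\{0,\dots,n_0^\ell-1\}$, $n_0^\ell=p+1+k^\ell(p-r-1)$, and $N_{i,p-1}^{r,\ell}$, $i\in\mathbf I_1^\ell=\{0,\dots,n_1^\ell-1\}$, $n_1^\ell=p+k^\ell(p-r-1)$. Geometry. $\mathbf F^{(L)},\mathbf F^{(R)}\in(\mathbb S_p^{r,0}\otimes\mathbb S_p^{r,0})^2$ are regular bijective maps $\mathbf F^{(S)}:[0,1]^2\to\Omega^{(S)}\subset\mathbb R^2$, $S\in\{L,R\}$. The patches share one whole edge $\Gamma=\Omega^{(L)}\cap\Omega^{(R)}$, parameterized by $\mathbf F_0(\xi_2)=\mathbf F^{(L)}(0,\xi_2)=\mathbf F^{(R)}(0,\xi_2)$, $\xi_2\in[0,1]$. The pair $\mathbf F=(\mathbf F^{(L)},\mathbf F^{(R)})$ is analysis-suitable $G^1$ if there are linear functions (polynomials of degree at most one) $\alpha^{(S)},\beta^{(S)}:[0,1]\to\mathbb R$, $S\in\{L,R\}$, with $\alpha^{(L)},\alpha^{(R)}$ relatively prime, such that for all $\xi_2\in[0,1]$: $\alpha^{(L)}(\xi_2)\alpha^{(R)}(\xi_2)<0$, and, with $\beta=\alpha^{(L)}\beta^{(R)}-\alpha^{(R)}\beta^{(L)}$,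 $$\alpha^{(R)}(\xi_2)\partial_1\mathbf F^{(L)}(0,\xi_2)-\alpha^{(L)}(\xi_2)\partial_1\mathbf F^{(R)}(0,\xi_2)+\beta(\xi_2)\partial_2\mathbf F^{(L)}(0,\xi_2)=\mathbf 0 .$$ Among the admissible linear functions, those minimizing $\|\alpha^{(L)}+1\|_{L^2([0,1])}^2+\|\alpha^{(R)}-1\|_{L^2([0,1])}^2$ and $\|\beta^{(L)}\|_{L^2([0,1])}^2+\|\beta^{(R)}\|_{L^2([0,1])}^2$ are fixed once and for all (for all levels). Functions of level $\ell$. The functions on $\Omega$ in the four sets forming $\Phi^\ell$ are defined through their compositions with $\mathbf F^{(S)}$, $S\in\{L,R\}$: (1) $\Phi^\ell_{\Omega^{(S')}}=\{\phi^{\Omega^{(S')},\ell}_{i,j}: i\in\mathbf I^\ell\setminus\{0,1\},\ j\in\mathbf I^\ell\}$, $S'\in\{L,R\}$, where $(\phi^{\Omega^{(S')},\ell}_{i,j}\circ\mathbf F^{(S)})(\xi_1,\xi_2)=N_{i,p}^{r,\ell}(\xi_1)N_{j,p}^{r,\ell}(\xi_2)$ if $S=S'$ and $0$ otherwise; (2) $\Phi^\ell_{\Gamma_0}=\{\phi^{\Gamma_0,\ell}_i:i\in\mathbf I_0^\ell\}$, where for $S\in\{L,R\}$ $$(\phi^{\Gamma_0,\ell}_i\circ\mathbf F^{(S)})(\xi_1,\xi_2)=N_{i,p}^{r+1,\ell}(\xi_2)\bigl(N_{0,p}^{r,\ell}(\xi_1)+N_{1,p}^{r,\ell}(\xi_1)\bigr)+\beta^{(S)}(\xi_2)\bigl(N_{i,p}^{r+1,\ell}\bigr)'(\xi_2)\tfrac{\tau_1^\ell}{p}N_{1,p}^{r,\ell}(\xi_1);$$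 (3) $\Phi^\ell_{\Gamma_1}=\{\phi^{\Gamma_1,\ell}_i:i\in\mathbf I_1^\ell\}$, where for $S\in\{L,R\}$ $$(\phi^{\Gamma_1,\ell}_i\circ\mathbf F^{(S)})(\xi_1,\xi_2)=\alpha^{(S)}(\xi_2)N_{i,p-1}^{r,\ell}(\xi_2)N_{1,p}^{r,\ell}(\xi_1).$$ *)

(* Defs.v *)
(* MathComp-Analysis, over an arbitrary R : realType. *)
From HB Require Import structures.
From mathcomp Require Import all_boot all_order all_algebra.
From mathcomp Require Import all_classical all_reals all_analysis.

Set Implicit Arguments.
Unset Strict Implicit.
Unset Printing Implicit Defensive.

Import Order.TTheory GRing.Theory Num.Theory.
Import numFieldNormedType.Exports.

Local Open Scope classical_set_scope.
Local Open Scope ring_scope.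

(* Knots. A list of breakpoints contains the internal ones only. *)

Fixpoint refine_from (R : realType) (x : R) (s : seq R) : seq R :=
  if s is y :: s' then [:: (x + y) / 2, y & refine_from y s']
  else [:: (x + 1) / 2].

Definition dyadic_refine (R : realType) (s : seq R) : seq R := refine_from 0 s.

Definition breakpoints (R : realType) (tau : seq R) (ell : nat) : seq R :=
  iter ell (@dyadic_refine R) tau.

(* Degree d, regularity s (s < d): the internal knots have multiplicity d - s. *)
Definition open_knots (R : realType) (d s : nat) (bp : seq R) : seq R :=
  nseq d.+1 0 ++ flatten [seq nseq (d - s)%N t | t <- bp] ++ nseq d.+1 1.

Definition spline_dim (R : realType) (d s : nat) (bp : seq R) : nat :=
  (d.+1 + size bp * (d - s))%N.

(* Cox-de Boor recursion for a knot sequence t ending at 1. A quotient with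
   zero denominator is 0, because x / 0 = 0 in a fieldType. The last nonempty
   knot span is closed on the right, so that the B-splines are the usual ones
   on the whole of [0, 1]. *)
Fixpoint bspline_rec (R : realType) (t : nat -> R) (d i : nat) (x : R) : R :=
  if d is d'.+1 then
    (x - t i) / (t (i + d)%N - t i) * bspline_rec t d' i x
    + (t (i + d).+1%N - x) / (t (i + d).+1%N - t i.+1) * bspline_rec t d' i.+1 x
  else if (t i <= x < t i.+1) || [&& x == 1, t i < 1 & t i.+1 == 1] then 1
  else 0.

(* The i-th B-spline (0 <= i < spline_dim d s bp), to be used on [0, 1] only. *)
Definition bspline (R : realType) (d s : nat) (bp : seq R) (i : nat) : R -> R :=
  bspline_rec (nth 0 (open_knots d s bp)) d i.

(* One-sided at 0 and 1, the ordinary derivative inside. *)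
Definition deriv01 (R : realType) (V : normedModType R) (f : R -> V) (x : R)
    : V :=
  lim (h^-1 *: (f (x + h) - f x)
         @[h --> within [set h | 0 <= x + h <= 1] 0^']).

Definition partial1 (R : realType) (G : R * R -> R * R) (x y : R) : R * R :=
  deriv01 (fun s => G (s, y)) x.

Definition partial2 (R : realType) (G : R * R -> R * R) (x y : R) : R * R :=
  deriv01 (fun s => G (x, s)) y.

Definition unit_square (R : realType) : set (R * R) := `[0, 1] `*` `[0, 1].

Variant side := Lside | Rside.

(* (S_p^{r,0} (x) S_p^{r,0})^2 *)
Definition spline_map (R : realType) (p r : nat) (tau : seq R)
    (G : R * R -> R * R) : Prop :=
  exists c : nat -> nat -> R * R, forall xi, unit_square xi ->
    G xi = \sum_(i < spline_dim p r tau) \sum_(j < spline_dim p r tau)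
             (bspline p r tau i xi.1 * bspline p r tau j xi.2) *: c i j.

Definition regular_map (R : realType) (G : R * R -> R * R) : Prop :=
  forall x y : R, unit_square (x, y) ->
    (partial1 G x y).1 * (partial2 G x y).2
    - (partial1 G x y).2 * (partial2 G x y).1 != 0.

Definition patch_image (R : realType) (F : side -> R * R -> R * R) (S : side)
    : set (R * R) := F S @` @unit_square R.

Definition Omega (R : realType) (F : side -> R * R -> R * R) : set (R * R) :=
  patch_image F Lside `|` patch_image F Rside.

(* Each F S is a bijection onto patch_image F S because it is injective. *)
Record two_patch_geometry (R : realType) (p r : nat) (tau : seq R)
    (F : side -> R * R -> R * R) : Prop := {
  tpg_spline : forall S, spline_map p r tau (F S);
  tpg_regular : forall S, regular_map (F S);
  tpg_inj : forall S (xi eta : R * R), unit_square xi -> unit_square eta ->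
    F S xi = F S eta -> xi = eta;
  tpg_edge : forall y : R, 0 <= y <= 1 -> F Lside (0, y) = F Rside (0, y);
  tpg_interface : patch_image F Lside `&` patch_image F Rside
    = [set F Lside (0, y) | y in `[0, 1]]
}.

(* Gluing data: a S and b S are the linear functions alpha^(S) and beta^(S). *)

Definition gluing_beta (R : realType) (a b : side -> {poly R}) : {poly R} :=
  a Lside * b Rside - a Rside * b Lside.

Record gluing_data (R : realType) (F : side -> R * R -> R * R)
    (a b : side -> {poly R}) : Prop := {
  gd_alpha_linear : forall S, (size (a S) <= 2)%N;
  gd_beta_linear : forall S, (size (b S) <= 2)%N;
  gd_coprime : coprimep (a Lside) (a Rside);
  gd_sign : forall y : R, 0 <= y <= 1 -> (a Lside).[y] * (a Rside).[y] < 0;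
  gd_G1 : forall y : R, 0 <= y <= 1 ->
    (a Rside).[y] *: partial1 (F Lside) 0 y
    - (a Lside).[y] *: partial1 (F Rside) 0 y
    + (gluing_beta a b).[y] *: partial2 (F Lside) 0 y = 0
}.

Definition analysis_suitable_G1 (R : realType) (F : side -> R * R -> R * R)
    : Prop := exists a b, gluing_data F a b.

Definition sq_norm_L2 (R : realType) (q : {poly R}) : R :=
  \int[@lebesgue_measure R]_(x in `[0, 1]) q.[x] ^+ 2.

Definition alpha_energy (R : realType) (a : side -> {poly R}) : R :=
  sq_norm_L2 (a Lside + 1) + sq_norm_L2 (a Rside - 1).

Definition beta_energy (R : realType) (b : side -> {poly R}) : R :=
  sq_norm_L2 (b Lside) + sq_norm_L2 (b Rside).

(* First alpha is chosen among all admissible pairs, then beta among the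
   admissible ones for that alpha. *)
Record selected_gluing_data (R : realType) (F : side -> R * R -> R * R)
    (a b : side -> {poly R}) : Prop := {
  sgd_admissible : gluing_data F a b;
  sgd_alpha_min : forall a' b', gluing_data F a' b' ->
    alpha_energy a <= alpha_energy a';
  sgd_beta_min : forall b', gluing_data F a b' ->
    beta_energy b <= beta_energy b'
}.

(* Functions on Omega are functions on the subtype Omega F of R * R. *)

(* f \o F^(S) = g S on [0, 1]^2, for both S; this determines f. *)
Definition pulls_back_to (R : realType) (F : side -> R * R -> R * R)
    (f : Omega F -> R) (g : side -> R -> R -> R) : Prop :=
  forall S (x y : R) (z : Omega F), unit_square (x, y) ->
    val z = F S (x, y) -> f z = g S x y.

Definition Phi_patch (R : realType) (p r : nat) (tau : seq R)
    (F : side -> R * R -> R * R) (ell : nat) (S' : side)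
    : set (Omega F -> R) :=
  let bp := breakpoints tau ell in
  [set f | exists i j, [/\ (2 <= i < spline_dim p r bp)%N,
    (j < spline_dim p r bp)%N &
    pulls_back_to f (fun S x y =>
      if `[< S = S' >] then bspline p r bp i x * bspline p r bp j y else 0)]].

Definition Phi_Gamma0 (R : realType) (p r : nat) (tau : seq R)
    (F : side -> R * R -> R * R) (b : side -> {poly R}) (ell : nat)
    : set (Omega F -> R) :=
  let bp := breakpoints tau ell in
  [set f | exists2 i, (i < spline_dim p r.+1 bp)%N &
    pulls_back_to f (fun S x y =>
      bspline p r.+1 bp i y * (bspline p r bp 0 x + bspline p r bp 1 x)
      + (b S).[y] * deriv01 (bspline p r.+1 bp i) y
        * (bp`_0 / p%:R * bspline p r bp 1 x))].

Definition Phi_Gamma1 (R : realType) (p r : nat) (tau : seq R)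
    (F : side -> R * R -> R * R) (a : side -> {poly R}) (ell : nat)
    : set (Omega F -> R) :=
  let bp := breakpoints tau ell in
  [set f | exists2 i, (i < spline_dim p.-1 r bp)%N &
    pulls_back_to f (fun S x y =>
      (a S).[y] * bspline p.-1 r bp i y * bspline p r bp 1 x)].

Definition Phi (R : realType) (p r : nat) (tau : seq R)
    (F : side -> R * R -> R * R) (a b : side -> {poly R}) (ell : nat)
    : set (Omega F -> R) :=
  @Phi_patch R p r tau F ell Lside `|` @Phi_patch R p r tau F ell Rside
  `|` @Phi_Gamma0 R p r tau F b ell `|` @Phi_Gamma1 R p r tau F a ell.

(* The restrictions to U of pairwise distinct members of A are linearly
   independent. *)
Definition lin_indep_on (R : realType) (T : Type) (U : set T)
    (A : set (T -> R)) : Prop :=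
  forall (m : nat) (f : 'I_m -> T -> R) (c : 'I_m -> R),
    injective f -> (forall i, A (f i)) ->
    (forall x, U x -> \sum_(i < m) c i * f i x = 0) ->
    forall i, c i = 0.

Definition locally_lin_indep (R : realType) (T : topologicalType)
    (A : set (T -> R)) : Prop :=
  forall U : set T, open U ->
    lin_indep_on U [set f | A f /\ ~ (forall x, U x -> f x = 0)].

(* Main.v *)
(* Let f be a basis function whose pullback g to a patch is nonzero at (x0, y0).
   On a small box with corner (x0, y0) every B-spline agrees with a polynomial,
   a vanishing combination of the pullbacks vanishes, and on the knot span
   [t_mu, t_(mu+1)) of degree d the B-splines with indices mu - d, ..., mu are
   linearly independent (by Marsden's identity they span the polynomials of
   degree d) while the others vanish. Comparing the coefficients of N_i(x)
   kills the functions of the patch (i >= 2). Since the first internal knot has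
   multiplicity p - r >= 2, N_0 and N_1 are both supported on the first span;
   there i = 0 yields sum c_j N_j^{r+1}(y) = 0, hence c_j = 0 for the active j,
   and then i = 1 yields alpha(y) sum d_j N_j^{p-1,r}(y) = 0 with alpha
   nonvanishing, hence d_j = 0. *)
Require Import Defs.
From HB Require Import structures.
From mathcomp Require Import all_boot all_order all_algebra.
From mathcomp Require Import all_classical all_reals all_analysis.
From mathcomp Require Import ring lra zify.

Set Implicit Arguments.
Unset Strict Implicit.
Unset Printing Implicit Defensive.

Import Order.TTheory GRing.Theory Num.Theory.
Import numFieldNormedType.Exports.

Local Open Scope classical_set_scope.
Local Open Scope ring_scope.

(** * Polynomial pieces of B-splines on one knot span, and their independence *)

(* The polynomial to which the i-th B-spline reduces on [t_mu, t_(mu+1)). *)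
Fixpoint span_poly (R : realType) (t : nat -> R) (mu d i : nat) : {poly R} :=
  if d is d'.+1 then
    (t (i + d)%N - t i)^-1 *: (('X - (t i)%:P) * span_poly t mu d' i)
    + (t (i + d).+1%N - t i.+1)^-1
      *: (((t (i + d).+1%N)%:P - 'X) * span_poly t mu d' i.+1)
  else (i == mu)%:R.

Lemma span_poly_out (R : realType) (t : nat -> R) (mu d i : nat) :
  ~~ (i <= mu <= i + d)%N -> span_poly t mu d i = 0.
Proof.
elim: d i => [|d IH] i hi /=; first by case: eqP => // ?; exfalso; lia.
by rewrite !IH ?mulr0 ?scaler0 ?addr0 //; lia.
Qed.

(** Induction on the degree: the recursion splits each piece of degree d + 1 into two of degree d,
    the outermost two vanish on the span, and the two contributions to each remaining piece combine
    into a factor y - X. *)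
Lemma marsden (R : realType) (t : nat -> R) (m d : nat) (y : R) :
  {homo t : i j / (i <= j)%N >-> i <= j} -> t (m + d)%N < t (m + d).+1 ->
  \sum_(j < d.+1) (\prod_(l < d) (y - t (m + j + l.+1)%N))
      *: span_poly t (m + d) d (m + j)
  = (y%:P - 'X) ^+ d.
Proof.
move=> t_homo; elim: d m => [|d IH] m t_lt.
  by rewrite big_ord1 big_ord0 scale1r /= eqxx expr0.
rewrite addnS -addSn in t_lt *.
rewrite exprS -(IH m.+1 t_lt) mulr_sumr.
under eq_bigr => j _ do rewrite [span_poly _ _ _ _]/= scalerDr.
rewrite big_split /= big_ord_recl /= addn0 (@span_poly_out _ _ _ _ m); last by lia.
rewrite mulr0 !scaler0 add0r.
rewrite [X in _ + X]big_ord_recr /= (@span_poly_out _ _ _ _ (m + d.+1).+1);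
  last by lia.
rewrite mulr0 !scaler0 addr0 -big_split /=; apply: eq_bigr => j _.
rewrite /bump /= add1n addnS -addSn.
set i := (m.+1 + j)%N.
have -> : (m + j)%N = i.-1 by rewrite /i; lia.
have iE : i = i.-1.+1 by rewrite /i; lia.
set D := t (i + d.+1)%N - t i.
(* The knots [t i] and [t (i + d.+1)] enclose the nonempty span [m.+1 + d], so the division is
   genuine. *)
have D0 : D != 0.
  rewrite subr_eq0 gt_eqF //; apply: le_lt_trans (lt_le_trans t_lt _).
    by apply: t_homo; move: (ltn_ord j); rewrite /i; lia.
  by apply: t_homo; rewrite /i; lia.
have -> : (i.-1 + d.+1).+1 = (i + d.+1)%N by rewrite -addSn -iE.
rewrite big_ord_recr [X in _ + X *: _]big_ord_recl /=.
under [in X in _ + X *: _]eq_bigr => l _.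
  rewrite (_ : (i.-1 + (bump 0 l).+1)%N = (i + l.+1)%N); last first.
    by rewrite /bump /= add1n -addSnnS -iE.
  over.
rewrite addn1 -iE.
set P := \prod_(l < d) _; set q := span_poly _ _ _ _.
rewrite -!mul_polyC.
have DP : D%:P * (D^-1)%:P = 1 :> {poly R} by rewrite -polyCM mulfV.
have DE : D%:P = (t (i + d.+1)%N)%:P - (t i)%:P :> {poly R} by rewrite polyCB.
rewrite !polyCM !polyCB.
(* With a = t_i and b = t_(i+d+1): (y - b)(X - a) + (y - a)(b - X) = (b - a)(y - X). *)
transitivity ((D%:P * (D^-1)%:P) * (P%:P * (y%:P - 'X) * q)); last first.
  by rewrite DP; ring.
by rewrite DE; ring.
Qed.

(** A Vandermonde matrix at the nodes 0, ..., d, its columns reversed and scaled by signed binomial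
    coefficients, which are nonzero in characteristic 0. *)
Lemma shifted_powers_unit (R : realType) (d : nat) :
  (\matrix_(k < d.+1, l < d.+1) (((k%:R : R)%:P - 'X) ^+ d)`_l) \in unitmx.
Proof.
set M := \matrix_(_, _) _.
have ME k l : M k l = (-1) ^+ l * (k%:R) ^+ (d - l) *+ 'C(d, l).
  rewrite mxE exprBn coef_sum (bigD1 l) //= big1 ?addr0 => [|i il].
    rewrite coefMn -!polyC_exp -(polyCN 1) -polyC_exp -polyCM coefCM coefXn.
    by rewrite eqxx mulr1.
  rewrite coefMn -!polyC_exp -(polyCN 1) -polyC_exp -polyCM coefCM coefXn.
  by rewrite (negPf (_ : l != i :> nat)) ?mulr0 ?mul0rn // eq_sym.
rewrite -unitmx_tr -row_free_unit -kermx_eq0; apply/rowV0P => v /sub_kermxP vM.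
(* The scaled kernel vector read as a polynomial of size at most d + 1; it has the d + 1 roots 0,
   ..., d. *)
pose q : {poly R} := \poly_(i < d.+1)
  ((-1) ^+ (d - i) * v 0 (inord (d - i)) *+ 'C(d, d - i)).
have q_root (k : 'I_d.+1) : root q k%:R.
  apply/rootP; rewrite horner_poly (reindex_inj rev_ord_inj) /=.
  have /matrixP/(_ 0 k) := vM; rewrite [in RHS]mxE => vM0.
  rewrite -[RHS]vM0 [in RHS]mxE; apply: eq_bigr => i _.
  rewrite [in RHS]mxE ME subSS subKn ?inord_val; last by rewrite -ltnS.
  by rewrite mulrnAr mulrnAl; congr (_ *+ _); ring.
have q0 : q = 0.
  apply/eqP/negPn/negP => q_neq0.
  have := max_poly_roots q_neq0 (rs := [seq k%:R | k <- iota 0 d.+1]).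
  rewrite size_map size_iota ltnNge size_poly => h.
  suff: false by [].
  apply: h.
    apply/allP => z /mapP[k]; rewrite mem_iota /= => kd ->.
    exact: (q_root (Ordinal kd)).
  by rewrite map_inj_uniq ?iota_uniq //; apply: mulrIn; exact: oner_neq0.
apply/rowP => i; rewrite mxE.
have := congr1 (fun p : {poly R} => p`_(d - i)) q0.
rewrite coef0 coef_poly ltnS leq_subr subKn; last by rewrite -ltnS.
rewrite inord_val => /eqP.
rewrite -mulr_natr !mulf_eq0 expf_eq0 oppr_eq0 oner_eq0 andbF /=.
by rewrite pnatr_eq0 -leqn0 leqNgt bin_gt0 -ltnS ltn_ord orbF => /eqP.
Qed.

(** Marsden's identity at y = 0, ..., d factors an invertible matrix as [C *m P], where the rows of
    [P] hold the coefficients of the pieces; hence [P] is invertible. *)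
Lemma span_poly_free (R : realType) (t : nat -> R) (m d : nat) (w : nat -> R) :
  {homo t : i j / (i <= j)%N >-> i <= j} -> t (m + d)%N < t (m + d).+1 ->
  \sum_(j < d.+1) w j *: span_poly t (m + d) d (m + j) = 0 ->
  forall j, (j <= d)%N -> w j = 0.
Proof.
move=> t_homo t_lt sum0 j jd.
pose P := \matrix_(j < d.+1, l < d.+1) (span_poly t (m + d) d (m + j))`_l.
pose C := \matrix_(k < d.+1, j < d.+1)
  \prod_(l < d) (k%:R - t (m + j + l.+1)%N).
have : C *m P \in unitmx.
  rewrite (_ : C *m P = \matrix_(k, l) (((k%:R : R)%:P - 'X) ^+ d)`_l).
    exact: shifted_powers_unit.
  apply/matrixP => k l; rewrite !mxE -(marsden _ t_homo t_lt) coef_sum.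
  by apply: eq_bigr => i _; rewrite !mxE coefZ.
rewrite unitmx_mul => /andP[_ Punit].
pose v := \row_(j < d.+1) w j.
suff v0 : v = 0.
  by have := congr1 (fun u : 'rV_d.+1 => u 0 (Ordinal (jd : (j < d.+1)%N))) v0;
    rewrite !mxE.
rewrite -(mulmxK Punit v) (_ : v *m P = 0) ?mul0mx //.
apply/rowP => l; rewrite !mxE -[RHS](coef0 R l) -sum0 coef_sum.
by apply: eq_bigr => i _; rewrite !mxE coefZ.
Qed.

Lemma corner_poly_eq0 (R : realType) (q : {poly R}) (x sigma e : R) :
  sigma != 0 -> 0 < e ->
  (forall h, 0 < h < e -> q.[x + sigma * h] = 0) -> q = 0.
Proof.
move=> sigma0 e0 q0; apply/eqP/negPn/negP => q_neq0.
(* The points e / (k + 2) lie strictly between 0 and e; [size q] of them are more roots than a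
   nonzero [q] can have. *)
pose z (k : nat) := x + sigma * (e / k.+2%:R).
have := max_poly_roots q_neq0 (rs := [seq z k | k <- iota 0 (size q)]).
rewrite size_map size_iota ltnn => h; suff: false by []; apply: h.
  apply/allP => y /mapP[k _ ->]; apply/rootP/q0.
  by rewrite divr_gt0 ?ltr0n //= ltr_pdivrMr ?ltr0n // ltr_pMr ?ltr1n.
rewrite map_inj_uniq ?iota_uniq // => k l /addrI/(mulfI sigma0).
move=> /(mulfI (lt0r_neq0 e0))/invr_inj/eqP.
by rewrite eqr_nat => /eqP[].
Qed.

(** * Knot sequences and the reduction of B-splines to their pieces *)

Lemma bspline_rec_eq (R : realType) (t u : nat -> R) (d i : nat) (x : R) :
  (forall j, (i <= j <= i + d.+1)%N -> t j = u j) ->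
  bspline_rec t d i x = bspline_rec u d i x.
Proof.
elim: d i => [|d IH] i tu; first by rewrite /= !tu //; lia.
by rewrite /= !IH ?tu // => *; rewrite ?tu //; lia.
Qed.

(** Both sides obey the same recursion, so only degree 0 matters; there monotonicity of the knots
    leaves [mu] as the only span containing x, also at the closed right end 1. *)
Lemma bspline_rec_span (R : realType) (t : nat -> R) (mu d i : nat) (x : R) :
  {homo t : j l / (j <= l)%N >-> j <= l} -> (forall j, t j <= 1) ->
  t mu < t mu.+1 -> (t mu <= x < t mu.+1) || ((x == 1) && (t mu.+1 == 1)) ->
  bspline_rec t d i x = (span_poly t mu d i).[x].
Proof.
move=> t_homo t_le1 t_lt x_in; elim: d i => [|d IH] i; last first.
  by rewrite /= !IH !hornerE; congr (_ * _ + _ * _); exact: mulrC.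
rewrite /=; have [i_mu|mu_i|->] := ltngtP i mu.
- have := t_homo _ _ i_mu; have := t_le1 mu.+1 => t_le t_i.
  rewrite mulr0n horner0 ifN //; apply/negP => /orP[/andP[]|/and3P[/eqP + + /eqP]];
    by case/orP: x_in => [/andP[]|/andP[/eqP + /eqP]] *; lra.
- have := t_homo _ _ mu_i; have := t_le1 i.+1 => t_le t_i.
  rewrite mulr0n horner0 ifN //; apply/negP => /orP[/andP[]|/and3P[/eqP + + /eqP]];
    by case/orP: x_in => [/andP[]|/andP[/eqP + /eqP]] *; lra.
- rewrite mulr1n ifT; first by rewrite hornerE.
  case/orP: x_in => [->//|/andP[-> /eqP h]].
  by move: t_lt; rewrite h => ->; rewrite eqxx orbT.
Qed.

(* The default 1 makes the sequence nondecreasing on all of [nat]; it differs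
   from the default 0 of [bspline] only beyond the indices used there. *)
Definition knot (R : realType) (d s : nat) (bp : seq R) : nat -> R :=
  nth 1 (open_knots d s bp).

Lemma path_nseq_cat (R : realType) (x y : R) (n : nat) (s : seq R) :
  x <= y -> path <=%R y s -> path <=%R x (nseq n y ++ s).
Proof.
move=> + ys; elim: n x => [|n IH] x xy /=; last by rewrite xy IH.
by case: s ys => //= z s /andP[yz ->]; rewrite (le_trans xy yz).
Qed.

Lemma size_knot_blocks (R : realType) (n : nat) (bp : seq R) :
  size (flatten [seq nseq n t | t <- bp]) = (size bp * n)%N.
Proof. by elim: bp => //= t bp IH; rewrite size_cat size_nseq IH mulSn. Qed.

Lemma size_open_knots (R : realType) (d s : nat) (bp : seq R) :
  size (open_knots d s bp) = (spline_dim d s bp + d.+1)%N.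
Proof. by rewrite !size_cat !size_nseq size_knot_blocks addnA. Qed.

Lemma knot_homo (R : realType) (d s : nat) (bp : seq R) :
  path <=%R 0 (rcons bp 1) ->
  {homo knot d s bp : i j / (i <= j)%N >-> i <= j}.
Proof.
move=> bp_path.
have blocks n m (x : R) : path <=%R x (rcons bp 1) ->
    path <=%R x (flatten [seq nseq n t | t <- bp] ++ nseq m 1).
  elim: bp x {bp_path} => [|y bp IH] x /= /andP[xy hp].
    by rewrite -[nseq m 1]cats0; apply: path_nseq_cat.
  by rewrite -catA; apply: path_nseq_cat => //; apply: IH.
have knots_sorted : sorted <=%R (open_knots d s bp).
  exact: (path_nseq_cat d (lexx 0) (blocks _ d.+1 _ bp_path)).
have knots_le1 : all (<= 1) (open_knots d s bp).
  have all_le1 (x : R) l : path <=%R x (rcons l 1) -> all (<= 1) l.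
    elim: l x => //= y l IH x /andP[_ hp]; rewrite (IH _ hp) andbT.
    have := order_path_min le_trans hp.
    by move=> /allP/(_ 1); apply; rewrite mem_rcons mem_head.
  apply/allP => y; rewrite !mem_cat => /or3P[/nseqP[-> _]|/flattenP[l]|/nseqP[-> _]].
  - exact: ler01.
  - case/mapP => z z_bp -> /nseqP[-> _].
    exact: (allP (all_le1 _ _ bp_path) z z_bp).
  - exact: lexx.
move=> i j ij; have [j_size|size_j] := ltnP j (size (open_knots d s bp)).
  apply: (sorted_leq_nth le_trans lexx) => //; rewrite inE //.
  exact: leq_ltn_trans j_size.
rewrite /knot (nth_default _ size_j).
have [i_size|size_i] := ltnP i (size (open_knots d s bp)).
  exact: (allP knots_le1 _ (mem_nth _ i_size)).
by rewrite nth_default.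
Qed.

Lemma knot_left (R : realType) (d s : nat) (bp : seq R) : knot d s bp d = 0.
Proof. by rewrite /knot nth_cat size_nseq ltnSn nth_nseq ltnSn. Qed.

Lemma knot_right (R : realType) (d s i : nat) (bp : seq R) :
  (spline_dim d s bp <= i)%N -> knot d s bp i = 1.
Proof.
move=> ni; rewrite /knot /open_knots catA nth_cat size_cat size_nseq.
rewrite size_knot_blocks ifN -?leqNgt // nth_nseq.
by case: ifP.
Qed.

Lemma knot_le1 (R : realType) (d s : nat) (bp : seq R) (i : nat) :
  path <=%R 0 (rcons bp 1) -> knot d s bp i <= 1.
Proof.
move=> bp_path; rewrite -(@knot_right _ d s (i + spline_dim d s bp) bp) ?leq_addl //.
by apply: knot_homo => //; exact: leq_addr.
Qed.

Lemma bspline_span (R : realType) (d s : nat) (bp : seq R) (mu i : nat) (x : R) :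
  path <=%R 0 (rcons bp 1) -> let t := knot d s bp in
  t mu < t mu.+1 -> (t mu <= x < t mu.+1) || ((x == 1) && (t mu.+1 == 1)) ->
  (i < spline_dim d s bp)%N ->
  bspline d s bp i x = (span_poly t mu d i).[x].
Proof.
move=> bp_path t t_lt x_in i_dim.
rewrite -(@bspline_rec_span _ _ _ _ _ x (knot_homo d s bp_path)) //; last first.
  by move=> j; apply: knot_le1.
apply: bspline_rec_eq => j j_bnd; apply: set_nth_default.
by rewrite size_open_knots; lia.
Qed.

(** * Corner intervals at a point of [0, 1] *)

(* At 1 the corner interval lies to the left: the last span is closed there. *)
Definition inward (R : realType) (x : R) : R := if x < 1 then 1 else -1.

Lemma inward_neq0 (R : realType) (x : R) : inward x != 0.
Proof. by rewrite /inward; case: ifP; rewrite ?oppr_eq0 oner_eq0. Qed.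

Lemma discrete_crossing (P : pred nat) (m n : nat) :
  (m <= n)%N -> P m -> ~~ P n -> exists2 k, (m <= k < n)%N & P k && ~~ P k.+1.
Proof.
elim: n => [|n IH]; first by rewrite leqn0 => /eqP -> ->.
rewrite leq_eqVlt => /orP[/eqP <- -> //|mn] Pm Pn1.
have [Pn|Pn] := boolP (P n); first by exists n; rewrite ?Pn ?Pn1 //; lia.
by have [k k_bnd ?] := IH mn Pm Pn; exists k => //; lia.
Qed.

(** The piece is valid from x inward up to the end of its span, which gives [e]. Including h = 0
    lets a nonzero value at x itself show that a B-spline is active on this span. *)
Lemma corner_span (R : realType) (d s : nat) (bp : seq R) (x : R) :
  path <=%R 0 (rcons bp 1) -> 0 <= x <= 1 -> let t := knot d s bp in
  exists mu e, [/\ (d <= mu < spline_dim d s bp)%N, t mu < t mu.+1, 0 < e &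
    forall h, 0 <= h < e -> 0 <= x + inward x * h <= 1 /\
      forall i, (i < spline_dim d s bp)%N ->
        bspline d s bp i (x + inward x * h)
        = (span_poly t mu d i).[x + inward x * h]].
Proof.
move=> bp_path x01 t; rewrite /inward.
have d_dim : (d <= spline_dim d s bp)%N by rewrite /spline_dim; lia.
have t_ge0 i : (d <= i)%N -> 0 <= t i.
  by move=> di; rewrite -(knot_left d s bp); apply: knot_homo.
case: ifPn => x1; last first.
  have xE : x = 1 by lra.
  (* At x = 1 the strict comparison selects the last nonempty span. *)
  have [||mu mu_bnd /andP[t_mu]] := @discrete_crossing (fun i => t i < 1) _ _ d_dim.
  - by rewrite /t knot_left ltr01.
  - by rewrite /t knot_right // ltxx.
  move=> t_mu1; have {}t_mu1 : t mu.+1 = 1.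
    by apply: le_anti; rewrite knot_le1 // leNgt.
  exists mu, (1 - t mu); rewrite t_mu1 subr_gt0; split=> // h h_bnd.
  have := t_ge0 mu; move=> /(_ (proj1 (andP mu_bnd))) t_mu0.
  split; first by lra.
  move=> i i_dim; apply: bspline_span => //; rewrite -/t ?t_mu1 //.
  have [->|h0] := eqVneq h 0; first by rewrite xE mulr0 addr0 !eqxx orbT.
  have h_gt0 : 0 < h by rewrite lt_neqAle eq_sym h0; case/andP: h_bnd.
  by apply/orP; left; lra.
have [||mu mu_bnd /andP[t_mu]] := @discrete_crossing (fun i => t i <= x) _ _ d_dim.
- by rewrite /t knot_left; case/andP: x01.
- by rewrite /t knot_right // -ltNge.
rewrite -ltNge => t_mu1.
exists mu, (t mu.+1 - x); split=> //; [lra|lra|] => h h_bnd.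
have := @knot_le1 _ d s _ mu.+1 bp_path; rewrite -/t => t_le1.
split; first by lra.
by move=> i i_dim; apply: bspline_span => //; rewrite -/t; lra.
Qed.

(** Only the indices mu - d, ..., mu give nonzero pieces, so the full sum is that of
    [span_poly_free] with m = mu - d. *)
Lemma span_poly_indep (R : realType) (d s : nat) (bp : seq R) (mu : nat)
    (w : nat -> R) :
  path <=%R 0 (rcons bp 1) -> let t := knot d s bp in
  (d <= mu < spline_dim d s bp)%N -> t mu < t mu.+1 ->
  \sum_(i < spline_dim d s bp) w i *: span_poly t mu d i = 0 ->
  forall i, (i <= mu <= i + d)%N -> w i = 0.
Proof.
move=> bp_path t mu_bnd t_lt.
have [m mE] : exists m, mu = (m + d)%N by exists (mu - d)%N; lia.
rewrite mE in mu_bnd t_lt *.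
rewrite -(big_mkord predT (fun i => w i *: span_poly t (m + d) d i)).
rewrite (big_cat_nat (n := m)) //=; last by lia.
rewrite big_nat_cond big1 ?add0r => [|i i_m]; last first.
  by rewrite span_poly_out ?scaler0 //; lia.
rewrite (big_cat_nat (n := (m + d.+1)%N)) //=; [|lia|lia].
rewrite [X in _ + X]big_nat_cond [X in _ + X]big1 ?addr0 => [|i i_m]; last first.
  by rewrite span_poly_out ?scaler0 //; lia.
rewrite -{1}[m]add0n big_addn addKn big_mkord => sum0 i i_mu.
rewrite -(subnK (_ : m <= i)%N); last by lia.
apply: (span_poly_free (t := t) (m := m) (d := d) (w := fun j => w (j + m)%N)) => //.
- exact: knot_homo.
- by rewrite -[RHS]sum0; apply: eq_bigr => j _; rewrite [(m + j)%N]addnC.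
- by lia.
Qed.

(** * Evaluation of [deriv01] *)

Lemma deriv01_poly (R : realType) (f : R -> R) (q : {poly R}) (y e : R) :
  0 < e -> (forall z, `|z - y| < e -> 0 <= z <= 1 /\ f z = q.[z]) ->
  deriv01 f y = q^`().[y].
Proof.
move=> e0 f_q; rewrite /deriv01.
set A := [set h | 0 <= y + h <= 1].
have near_e : \forall h \near (0 : R)^', `|h| < e.
  by exists e => //= h; rewrite /ball_ /= sub0r normrN.
have f_q_near h : `|h| < e -> 0 <= y + h <= 1 /\ f (y + h) = q.[y + h].
  by move=> he; apply: f_q; rewrite addrAC subrr add0r.
(* By hypothesis a whole neighbourhood of y lies in [0, 1], so the restriction to [A] disappears. *)
have -> : within A (0 : R)^' = (0 : R)^'.
  apply/seteqP; split => P; last by apply: filterS => h Ph _.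
  move=> wP; apply: filterS2 near_e wP => h he; apply.
  by have [] := f_q_near h he.
have [q_derivable <-] := is_derive_poly q y.
apply: cvg_lim => //; apply: cvg_trans q_derivable.
apply: near_eq_cvg; near=> h.
have he : `|h| < e by near: h.
have n0e : `|0 : R| < e by rewrite normr0.
have [_ ->] := f_q_near h he; have [_] := f_q_near 0 n0e; rewrite addr0 => ->.
by rewrite /= -[h%:A]/(h * 1) mulr1 [h + y]addrC.
Unshelve. all: by end_near.
Qed.

(* If the difference quotient diverges, [lim] is the junk value [point = 0]. *)
Lemma deriv01_corner0 (R : realType) (f : R -> R) (y sigma e : R) :
  sigma != 0 -> 0 < e ->
  (forall h, 0 <= h < e -> 0 <= y + sigma * h <= 1 /\ f (y + sigma * h) = 0) ->
  deriv01 f y = 0.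
Proof.
move=> sigma0 e0 f0; rewrite /deriv01.
set A := [set h | 0 <= y + h <= 1]; set F := within A (0 : R)^'.
set g := fun h : R => _; have [cvg_g|] := pselect (cvg (g @ F)); last exact: dvgP.
set l := lim (g @ F) in cvg_g *; apply/eqP/negPn/negP => l0.
have nl0 : 0 < `|l| by rewrite normr_gt0.
have := @cvgr_dist_lt _ _ _ _ _ g l cvg_g _ nl0.
move=> [d /= d0 gd].
(* At [sigma * h] the quotient should be closer to the limit l than [|l|], yet it is 0. *)
pose h := Num.min (e / 2) (d / 2 / `|sigma|).
have s0 : 0 < `|sigma| by rewrite normr_gt0.
have h0 : 0 < h by rewrite lt_min !divr_gt0.
have he : h < e by rewrite gt_min ltr_pdivrMr // ltr_pMr // ltr1n.
have hd : `|sigma * h| < d.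
  rewrite normrM (gtr0_norm h0) mulrC -ltr_pdivlMr // gt_min; apply/orP; right.
  by rewrite ltr_pM2r ?invr_gt0 // ltr_pdivrMr // ltr_pMr // ltr1n.
have [|h01 fh] := f0 h; first by rewrite he ltW.
have [|_] := f0 0; first by rewrite lexx.
rewrite mulr0 addr0 => fy.
have := gd (sigma * h); rewrite /ball_ /= sub0r normrN.
rewrite /g fh fy subrr scaler0 subr0 ltxx.
by move=> contra; have := contra hd (mulf_neq0 sigma0 (lt0r_neq0 h0)) h01.
Qed.

(** * Refined breakpoints, and the geometry map near a corner *)

Lemma refine_from_path (R : realType) (x : R) (s : seq R) :
  path <=%R x (rcons s 1) -> path <=%R x (rcons (refine_from x s) 1).
Proof.
elim: s x => [|y s IH] x /= /andP[xy hs]; first by rewrite andbT; lra.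
by rewrite IH // andbT; lra.
Qed.

Lemma breakpoints_path (R : realType) (tau : seq R) (ell : nat) :
  path <%R 0 (rcons tau 1) -> path <=%R 0 (rcons (breakpoints tau ell) 1).
Proof.
move=> tau_path; elim: ell => [|ell IH].
  by apply: sub_path tau_path => x y /ltW.
by rewrite /breakpoints iterS; exact: refine_from_path.
Qed.

Lemma size_breakpoints_gt0 (R : realType) (tau : seq R) (ell : nat) :
  (0 < size tau)%N -> (0 < size (breakpoints tau ell))%N.
Proof.
elim: ell => [//|ell IH] /IH; rewrite /breakpoints iterS.
by case: (iter _ _ _).
Qed.

(** It makes the span [d.+1] empty, so that N_1, like N_0, is active on the first span only. *)
Lemma knot_first_double (R : realType) (d s : nat) (bp : seq R) :
  (0 < size bp)%N -> (2 <= d - s)%N -> knot d s bp d.+1 = knot d s bp d.+2.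
Proof.
case: bp => // y bp _; rewrite /knot /open_knots.
case: (d - s)%N => [|[|n]] // _.
by rewrite !nth_cat !size_nseq ltnn [(d.+2 < _)%N]ltnNge leqnSn /= subnn subSnn.
Qed.

(** [G] is arbitrary off the unit square, so its continuity is used only from inside: on a small
    corner box it equals the polynomial map [g]. *)
Lemma spline_map_corner (R : realType) (p r : nat) (tau : seq R)
    (G : R * R -> R * R) (V : set (R * R)) (x y : R) :
  path <=%R 0 (rcons tau 1) -> spline_map p r tau G ->
  0 <= x <= 1 -> 0 <= y <= 1 -> open V -> V (G (x, y)) ->
  exists2 e, 0 < e & forall h h', 0 < h < e -> 0 < h' < e ->
    unit_square (x + inward x * h, y + inward y * h') /\
    V (G (x + inward x * h, y + inward y * h')).
Proof.
move=> tau_path [c Gc] x01 y01 oV VG.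
have [mu [e1 [_ _ e1_gt0 x_poly]]] := corner_span p r tau_path x01.
have [nu [e2 [_ _ e2_gt0 y_poly]]] := corner_span p r tau_path y01.
set t := knot p r tau in x_poly y_poly.
pose P i := span_poly t mu p i; pose Q j := span_poly t nu p j.
pose X (u : R * R) := x + inward x * u.1.
pose Y (u : R * R) := y + inward y * u.2.
pose g (u : R * R) := \sum_(i < spline_dim p r tau) \sum_(j < spline_dim p r tau)
             ((P i).[X u] * (Q j).[Y u]) *: c i j.
have gE h h' : 0 <= h < e1 -> 0 <= h' < e2 ->
    unit_square (X (h, h'), Y (h, h')) /\ G (X (h, h'), Y (h, h')) = g (h, h').
  move=> /x_poly[x_in x_eq] /y_poly[y_in y_eq].
  have sq : unit_square (X (h, h'), Y (h, h')) by split; rewrite /= in_itv.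
  split=> //; rewrite Gc //; apply: eq_bigr => i _; apply: eq_bigr => j _.
  by rewrite /X /Y /= x_eq ?y_eq.
have g_cont : g u @[u --> ((0, 0) : R * R)] --> g (0, 0).
  have X_cont : X u @[u --> ((0, 0) : R * R)] --> X (0, 0).
    by apply: cvgD; [exact: cvg_cst | apply: cvgMl_tmp; exact: cvg_fst].
  have Y_cont : Y u @[u --> ((0, 0) : R * R)] --> Y (0, 0).
    by apply: cvgD; [exact: cvg_cst | apply: cvgMl_tmp; exact: cvg_snd].
  apply: cvg_big => [|i _]; first exact: add_continuous.
  apply: cvg_big => [|j _]; first exact: add_continuous.
  apply: cvgZr_tmp; apply: cvgM.
    exact: (cvg_comp _ _ X_cont (@continuous_horner _ (P i) _)).
  exact: (cvg_comp _ _ Y_cont (@continuous_horner _ (Q j) _)).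
have [||_ G0] := gE 0 0; rewrite ?lexx //.
have Vg : nbhs (g (0, 0)) V.
  by apply: open_nbhs_nbhs; split=> //; rewrite -G0 /X /Y /= !mulr0 !addr0.
have [e /= e0 eV] := proj1 (nbhs_ballP _ _) (g_cont V Vg).
exists (Num.min e (Num.min e1 e2)); first by rewrite !lt_min e0 e1_gt0.
move=> h h'; rewrite !lt_min => /and4P[h0 he he1 _] /and4P[h'0 h'e _ h'e2].
have [||sq Ghh'] := gE h h'; rewrite ?ltW //.
split=> //; rewrite -[x + _]/(X (h, h')) -[y + _]/(Y (h, h')) Ghh'; apply: eV.
by split; rewrite /= -ball_normE /ball_ /= sub0r normrN gtr0_norm.
Qed.

(** * Labels of the basis functions, and pullbacks expanded in the first variable *)

(** A label fixes the pullbacks to both patches, so the linear algebra can run over labels instead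
    of functions on [Omega F]. *)
Variant basis_index :=
  PatchIndex of side & nat & nat | Gamma0Index of nat | Gamma1Index of nat.

Definition basis_index_valid (R : realType) (p r : nat) (bp : seq R)
    (ix : basis_index) : bool :=
  match ix with
  | PatchIndex _ i j =>
      (2 <= i < spline_dim p r bp)%N && (j < spline_dim p r bp)%N
  | Gamma0Index i => (i < spline_dim p r.+1 bp)%N
  | Gamma1Index i => (i < spline_dim p.-1 r bp)%N
  end.

Definition basis_pullback (R : realType) (p r : nat) (bp : seq R)
    (a b : side -> {poly R}) (ix : basis_index) (S : side) (x y : R) : R :=
  match ix with
  | PatchIndex S' i j =>
      if `[< S = S' >] then bspline p r bp i x * bspline p r bp j y else 0
  | Gamma0Index i =>
      bspline p r.+1 bp i y * (bspline p r bp 0 x + bspline p r bp 1 x)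
      + (b S).[y] * deriv01 (bspline p r.+1 bp i) y
        * (bp`_0 / p%:R * bspline p r bp 1 x)
  | Gamma1Index i =>
      (a S).[y] * bspline p.-1 r bp i y * bspline p r bp 1 x
  end.

Lemma Phi_basis (R : realType) (p r : nat) (tau : seq R)
    (F : side -> R * R -> R * R) (a b : side -> {poly R}) (ell : nat)
    (f : Omega F -> R) :
  Phi p r tau a b ell f -> let bp := breakpoints tau ell in
  exists2 ix, basis_index_valid p r bp ix
    & pulls_back_to f (basis_pullback p r bp a b ix).
Proof.
move=> Phi_f bp.
case: Phi_f => [[[[i [j [i_bnd j_bnd f_pull]]]|[i [j [i_bnd j_bnd f_pull]]]]
  |[i i_bnd f_pull]]|[i i_bnd f_pull]].
- by exists (PatchIndex Lside i j); first by rewrite /= i_bnd.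
- by exists (PatchIndex Rside i j); first by rewrite /= i_bnd.
- by exists (Gamma0Index i).
- by exists (Gamma1Index i).
Qed.

(* The coefficient of [bspline p r bp i x] in the pullback, as a function of
   the second variable. *)
Definition trace_coef (R : realType) (p r : nat) (bp : seq R)
    (a b : side -> {poly R}) (S : side) (i : nat) (ix : basis_index) (y : R)
    : R :=
  match ix with
  | PatchIndex S' i' j =>
      if `[< S = S' >] && (i == i') then bspline p r bp j y else 0
  | Gamma0Index j =>
      if i is 0 then bspline p r.+1 bp j y
      else if i is 1 then
        bspline p r.+1 bp j y
        + (b S).[y] * deriv01 (bspline p r.+1 bp j) y * (bp`_0 / p%:R)
      else 0
  | Gamma1Index j =>
      if i is 1 then (a S).[y] * bspline p.-1 r bp j y else 0
  end.

Lemma basis_pullback_trace (R : realType) (p r : nat) (bp : seq R)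
    (a b : side -> {poly R}) (ix : basis_index) (S : side) (x y : R) :
  (0 < p)%N -> basis_index_valid p r bp ix ->
  basis_pullback p r bp a b ix S x y =
  \sum_(i < spline_dim p r bp) trace_coef p r bp a b S i ix y
      * bspline p r bp i x.
Proof.
move=> p_gt0; have [n nE] : exists n, spline_dim p r bp = n.+2.
  by exists (spline_dim p r bp).-2; rewrite /spline_dim; lia.
case: ix => [S' i j|j|j] /=.
- move=> /andP[/andP[_ i_bnd] _]; rewrite (bigD1 (Ordinal i_bnd)) //= big1.
    by rewrite eqxx andbT addr0; case: ifP => _; rewrite ?mul0r // mulrC.
  move=> l l_i; rewrite ifN ?mul0r // negb_and; apply/orP; right.
  by apply: contra l_i => /eqP l_i; apply/eqP/val_inj.
- move=> _; rewrite nE !big_ord_recl big1 /= => [|l _]; last by rewrite mul0r.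
  by rewrite /bump /=; ring.
- move=> _; rewrite nE !big_ord_recl big1 /= => [|l _]; last by rewrite mul0r.
  by rewrite /bump /=; ring.
Qed.

(** * Comparison of coefficients on a corner box *)

(** The labels [sel j] have the B-splines of one univariate space as their parts [G], and all other
    labels present contribute zero; a vanishing combination near y is then one of span polynomials.
    It serves in turn for [Gamma0Index], [Gamma1Index] and [PatchIndex S i] with i fixed. *)
Lemma selected_coef_eq0 (R : realType) (d s : nat) (bp : seq R) (y e : R)
    (mu m : nat) (idx : 'I_m -> basis_index) (c : 'I_m -> R)
    (sel : nat -> basis_index) (G : basis_index -> R -> R) :
  path <=%R 0 (rcons bp 1) -> injective idx -> injective sel ->
  let t := knot d s bp in
  (d <= mu < spline_dim d s bp)%N -> t mu < t mu.+1 -> 0 < e ->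
  (forall h, 0 < h < e -> forall j, (j < spline_dim d s bp)%N ->
     bspline d s bp j (y + inward y * h)
     = (span_poly t mu d j).[y + inward y * h]) ->
  (forall j z, G (sel j) z = bspline d s bp j z) ->
  (forall l, (exists2 j, (j < spline_dim d s bp)%N & idx l = sel j) \/
     forall z, G (idx l) z = 0) ->
  (forall h, 0 < h < e -> \sum_(l < m) c l * G (idx l) (y + inward y * h) = 0) ->
  forall l j, idx l = sel j -> (j <= mu <= j + d)%N -> c l = 0.
Proof.
move=> bp_path idx_inj sel_inj t mu_bnd t_lt e_gt0 b_poly G_sel G_out sum0.
(* The 0-1 incidence matrix between the given labels and the family; as [idx] is injective, each sum
   [w j] has at most one nonzero term. *)
pose hit l j : R := `[< idx l = sel j >]%:R.
have hit_sel l j j' : idx l = sel j -> hit l j' = (j' == j)%:R.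
  move=> lj; rewrite /hit lj; congr (_ %:R); congr nat_of_bool.
  by apply/asboolP/eqP => [/sel_inj|->].
have G_hit l z : G (idx l) z =
    \sum_(j < spline_dim d s bp) hit l j * bspline d s bp j z.
  have [[j j_bnd lj]|no_hit] :=
      pselect (exists2 j, (j < spline_dim d s bp)%N & idx l = sel j).
    rewrite lj G_sel (bigD1 (Ordinal j_bnd)) //= (hit_sel _ _ _ lj) eqxx mul1r.
    rewrite big1 ?addr0 // => i i_j; rewrite (hit_sel _ _ _ lj).
    by rewrite (negPf (i_j : (i : nat) != j)) mul0r.
  have [//|G0] := G_out l; rewrite G0 big1 // => i _.
  rewrite /hit asboolF ?mul0r // => li; apply: no_hit.
  by exists i.
pose w j := \sum_(l < m) c l * hit l j.
have w0 : \sum_(j < spline_dim d s bp) w j *: span_poly t mu d j = 0.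
  apply: (corner_poly_eq0 (inward_neq0 y) e_gt0) => h he.
  rewrite horner_sum -[RHS](sum0 _ he).
  under [RHS]eq_bigr => l _ do rewrite G_hit mulr_sumr.
  rewrite exchange_big; apply: eq_bigr => j _ /=.
  rewrite hornerZ mulr_suml; apply: eq_bigr => l _.
  by rewrite b_poly // mulrA.
move=> l j lj j_mu.
have := span_poly_indep bp_path mu_bnd t_lt w0 j_mu.
rewrite /w (bigD1 l) //= (hit_sel _ _ _ lj) eqxx mulr1 big1 ?addr0 // => l' l'_l.
rewrite /hit asboolF ?mulr0 // -lj => /idx_inj l'E.
by rewrite l'E eqxx in l'_l.
Qed.

Lemma corner_coef_eq0 (R : realType) (p r m : nat) (bp : seq R)
    (a b : side -> {poly R}) (idx : 'I_m -> basis_index) (c : 'I_m -> R)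
    (S : side) (x y e : R) (k : 'I_m) :
  (0 < p)%N -> (2 <= p - r)%N -> (0 < size bp)%N ->
  path <=%R 0 (rcons bp 1) -> injective idx ->
  (forall l, basis_index_valid p r bp (idx l)) ->
  (forall z, 0 <= z <= 1 -> (a S).[z] != 0) ->
  0 <= x <= 1 -> 0 <= y <= 1 -> 0 < e ->
  (forall h h', 0 < h < e -> 0 < h' < e ->
     \sum_(l < m) c l * basis_pullback p r bp a b (idx l) S
        (x + inward x * h) (y + inward y * h') = 0) ->
  basis_pullback p r bp a b (idx k) S x y != 0 -> c k = 0.
Proof.
move=> p_gt0 pr bp_gt0 bp_path idx_inj idx_valid a_neq0 x01 y01 e_gt0 sum0.
(* One span in x but three in y: the three univariate spaces number their spans differently. *)
have [mu [ex [mu_bnd t_lt ex_gt0 x_poly]]] := corner_span p r bp_path x01.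
have [nu [ey [nu_bnd u_lt ey_gt0 y_poly]]] := corner_span p r bp_path y01.
have [nu0 [e0 [nu0_bnd u0_lt e0_gt0 y0_poly]]] := corner_span p r.+1 bp_path y01.
have [nu1 [e1 [nu1_bnd u1_lt e1_gt0 y1_poly]]] := corner_span p.-1 r bp_path y01.
pose dx := Num.min e ex; pose dy := Num.min e (Num.min ey (Num.min e0 e1)).
have dx_gt0 : 0 < dx by rewrite lt_min e_gt0.
have dy_gt0 : 0 < dy by rewrite !lt_min e_gt0 ey_gt0 e0_gt0.
have dyP h : 0 < h < dy ->
    [/\ 0 < h < e, 0 <= h < ey, 0 <= h < e0 & 0 <= h < e1].
  rewrite !lt_min => /andP[h0 /and4P[-> -> -> ->]].
  by rewrite h0 ltW.
(* For fixed second variable the combination is a polynomial in the first, so the coefficient of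
   each active N_i(x) vanishes. *)
have row0 h i : 0 < h < dy -> (i <= mu <= i + p)%N ->
    \sum_(l < m) c l * trace_coef p r bp a b S i (idx l) (y + inward y * h) = 0.
  move=> h_dy; have [h_e _ _ _] := dyP h h_dy.
  pose w i := \sum_(l < m)
    c l * trace_coef p r bp a b S i (idx l) (y + inward y * h).
  apply: (span_poly_indep (w := w) bp_path mu_bnd t_lt).
  apply: (corner_poly_eq0 (inward_neq0 x) dx_gt0) => h'.
  rewrite lt_min => /and3P[h'0 h'e h'ex].
  have [|_ x_eq] := x_poly h'; first by rewrite ltW.
  rewrite horner_sum -[RHS](sum0 h' h) ?h'0 //.
  under [RHS]eq_bigr => l _ do rewrite basis_pullback_trace // mulr_sumr.
  rewrite exchange_big; apply: eq_bigr => j _ /=.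
  rewrite hornerZ mulr_suml; apply: eq_bigr => l _.
  by rewrite x_eq // mulrA.
have corner0 (f : R -> R) z : f (z + inward z * 0) = f z by rewrite mulr0 addr0.
have x_out i : (i < spline_dim p r bp)%N -> ~~ (i <= mu <= i + p)%N ->
    bspline p r bp i x = 0.
  have [|_ x_eq] := x_poly 0; first by rewrite lexx.
  by move=> i_bnd i_mu; rewrite -corner0 x_eq // span_poly_out // horner0.
have y_out j : (j < spline_dim p r bp)%N -> ~~ (j <= nu <= j + p)%N ->
    bspline p r bp j y = 0.
  have [|_ y_eq] := y_poly 0; first by rewrite lexx.
  by move=> j_bnd j_nu; rewrite -corner0 y_eq // span_poly_out // horner0.
have y0_out j : (j < spline_dim p r.+1 bp)%N -> ~~ (j <= nu0 <= j + p)%N ->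
    forall h, 0 <= h < e0 -> 0 <= y + inward y * h <= 1 /\
      bspline p r.+1 bp j (y + inward y * h) = 0.
  move=> j_bnd j_nu h he; have [h01 y_eq] := y0_poly h he; split=> //.
  by rewrite y_eq // span_poly_out // horner0.
have y1_out j : (j < spline_dim p.-1 r bp)%N -> ~~ (j <= nu1 <= j + p.-1)%N ->
    bspline p.-1 r bp j y = 0.
  have [|_ y_eq] := y1_poly 0; first by rewrite lexx.
  by move=> j_bnd j_nu; rewrite -corner0 y_eq // span_poly_out // horner0.
have deriv_out j h : (j < spline_dim p r.+1 bp)%N ->
    ~~ (j <= nu0 <= j + p)%N -> 0 < h < dy ->
    deriv01 (bspline p r.+1 bp j) (y + inward y * h) = 0.
  move=> j_bnd j_nu h_dy; have [_ _ /andP[_ he0] _] := dyP h h_dy.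
  have h0 : 0 < h by case/andP: h_dy.
  (* Inside the box the inactive spline vanishes on both sides; the radius keeps z between the
     corner and the end of the span. *)
  rewrite (deriv01_poly (q := 0) (e := Num.min h (e0 - h))) ?deriv0 ?horner0 //.
    by rewrite lt_min h0 subr_gt0.
  move=> z; rewrite lt_min => /andP[zh zeh].
  have -> : z = y + inward y * (inward y * (z - y)).
    by rewrite mulrA /inward; case: ifP => _; ring.
  rewrite horner0; apply: (y0_out j j_bnd j_nu).
  by clear - zh zeh; move: zh zeh; rewrite /inward !ltr_norml; case: ifP => _; lra.
have n_gt1 : (1 < spline_dim p r bp)%N by rewrite /spline_dim addSn ltnS ltn_addr.
(* N_0 and N_1 are active at most on the spans up to p + 1, and the span p + 1 is empty. *)
have mu_p : bspline p r bp 1 x != 0 \/ bspline p r bp 0 x != 0 -> mu = p.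
  have mu_neq : mu != p.+1.
    apply/eqP => muE; move: t_lt; rewrite muE knot_first_double ?ltxx //.
  case=> N_neq0; apply/eqP/negPn/negP => mu_p; move/negP: N_neq0; apply; apply/eqP;
    by apply: x_out => //; clear - mu_p mu_neq mu_bnd; lia.
(* Row i = 0 contains contributions of [Gamma0Index] labels only. *)
have Gamma0_eq0 l j : mu = p -> idx l = Gamma0Index j ->
    (j <= nu0 <= j + p)%N -> c l = 0.
  move=> muE; apply: (selected_coef_eq0 (y := y) bp_path idx_inj (sel := Gamma0Index)
    (G := trace_coef p r bp a b S 0) _ nu0_bnd u0_lt dy_gt0) => //.
  - by move=> j1 j2 [].
  - by move=> h h_dy j' j'_bnd; have [_ _ he _] := dyP h h_dy;
      have [_ ->] := y0_poly h he.
  - move=> l'; have := idx_valid l'; case: (idx l') => [S' i' j'|j'|j'] /=.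
    + case/andP=> /andP[i'_ge2 _] _; right => z.
      by rewrite (ltn_eqF (ltnW i'_ge2)) andbF.
    + by move=> j'_bnd; left; exists j'.
    + by right.
  - by move=> h h_dy; apply: row0 => //; rewrite muE add0n leqnn.
have Gamma1_eq0 l j : mu = p -> idx l = Gamma1Index j ->
    (j <= nu1 <= j + p.-1)%N -> c l = 0.
  move=> muE.
  pose G ix z := if ix is Gamma1Index j then bspline p.-1 r bp j z else 0.
  apply: (selected_coef_eq0 (y := y) bp_path idx_inj (sel := Gamma1Index)
    (G := G) _ nu1_bnd u1_lt dy_gt0) => //.
  - by move=> j1 j2 [].
  - by move=> h h_dy j' j'_bnd; have [_ _ _ he] := dyP h h_dy;
      have [_ ->] := y1_poly h he.
  - move=> l'; have := idx_valid l'; case: (idx l') => [S' i' j'|j'|j'] /=;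
      [by right|by right|by move=> j'_bnd; left; exists j'].
  - move=> h h_dy; set z := y + inward y * h.
    have [_ h_ey h_e0 _] := dyP h h_dy; have [z01 _] := y_poly h h_ey.
    (* Multiplied by the nonzero alpha(z), the sum becomes row i = 1: an interface function of the
       other kind has coefficient 0 if its spline is active, and otherwise its spline and derivative
       vanish at z. *)
    apply: (mulfI (a_neq0 z z01)); rewrite mulr0 -[RHS](row0 h 1%N h_dy); last first.
      by rewrite muE p_gt0 add1n leqnSn.
    rewrite mulr_sumr; apply: eq_bigr => l' _.
    have := idx_valid l'; case l'E: (idx l') => [S' i' j'|j'|j'] /=.
    + by case/andP=> /andP[i'_ge2 _] _; rewrite (ltn_eqF i'_ge2) andbF !mulr0.
    + move=> j'_bnd; rewrite !mulr0.
      have [j'_nu|j'_nu] := boolP (j' <= nu0 <= j' + p)%N.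
        by rewrite (Gamma0_eq0 l' j') // mul0r.
      rewrite deriv_out //.
      have [_ ->] := y0_out j' j'_bnd j'_nu h h_e0.
      by rewrite mulr0 mul0r addr0 mulr0.
    + by move=> _; ring.
have := idx_valid k; case kE: (idx k) => [S' i j|j|j] /=.
- move=> /andP[/andP[i_ge2 i_bnd] j_bnd].
  case: asboolP => [SS'|]; last by rewrite eqxx.
  rewrite mulf_eq0 negb_or => /andP[Nx Ny].
  have i_mu : (i <= mu <= i + p)%N by apply: contraR Nx => ?; rewrite x_out.
  have j_nu : (j <= nu <= j + p)%N by apply: contraR Ny => ?; rewrite y_out.
  (* Row i with i >= 2 contains only functions of patch [S] with first index i. *)
  apply: (selected_coef_eq0 (y := y) bp_path idx_inj (sel := PatchIndex S i)
    (G := trace_coef p r bp a b S i) _ nu_bnd u_lt dy_gt0 _ _ _ _ _ j_nu) => //.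
  + by move=> j1 j2 [].
  + by move=> h h_dy j' j'_bnd; have [_ he _ _] := dyP h h_dy;
      have [_ ->] := y_poly h he.
  + by move=> j' z; rewrite /= eqxx andbT asboolT.
  + move=> l; have := idx_valid l; case: (idx l) => [S1 i1 j1|j1|j1] /=.
    * case/andP=> _ j1_bnd; case: asboolP => [<-|_] /=; last by right.
      by have [->|_] := eqVneq i i1; [left; exists j1|right].
    * by case: i i_ge2 {Nx i_bnd i_mu kE} => [|[|i]] // _ _; right.
    * by case: i i_ge2 {Nx i_bnd i_mu kE} => [|[|i]] // _ _; right.
  + by move=> h h_dy; exact: row0.
  + by rewrite kE SS'.
- move=> j_bnd pull_neq0.
  have muE : mu = p.
    apply: mu_p; have [N1|] := eqVneq (bspline p r bp 1 x) 0; last by left.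
    have [N0|] := eqVneq (bspline p r bp 0 x) 0; last by right.
    by move: pull_neq0; rewrite N0 N1 !(mulr0, addr0) eqxx.
  apply: (Gamma0_eq0 k j muE kE); apply: contraR pull_neq0 => j_nu.
  (* At the corner itself the inactive spline is known to vanish on one side only, so the one-sided
     lemma replaces [deriv_out]. *)
  rewrite (deriv01_corner0 (inward_neq0 y) e0_gt0 (y0_out j j_bnd j_nu)).
  have [|_] := y0_out j j_bnd j_nu 0; first by rewrite lexx.
  by rewrite corner0 => ->; rewrite mulr0 !mul0r addr0.
- move=> j_bnd; rewrite !mulf_eq0 !negb_or => /andP[/andP[_ Ny] Nx].
  apply: (Gamma1_eq0 k j _ kE); first by apply: mu_p; left.
  by apply: contraR Ny => ?; rewrite y1_out.
Qed.

(** * Transfer from corner boxes to open subsets of the two-patch domain *)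

Theorem proposition3 (R : realType) (k p r N : nat) (tau : k.-tuple R)
    (F : side -> R * R -> R * R) (a b : side -> {poly R}) :
  (0 < k)%N -> (3 <= p)%N -> (1 <= r <= p - 2)%N -> (1 <= N)%N ->
  path <%R 0 (rcons tau 1) ->
  two_patch_geometry p r tau F ->
  analysis_suitable_G1 F ->
  selected_gluing_data F a b ->
  forall ell : nat, (ell < N)%N ->
    locally_lin_indep (@Phi R p r tau F a b ell).
Proof.
move=> k_gt0 p_ge3 r_bnd _ tau_path geom _ [gluing _ _] ell _ U oU.
move=> m f c f_inj f_Phi sum0 i.
pose bp := breakpoints tau ell.
have [idx idx_f] : {idx : 'I_m -> basis_index & forall l,
    basis_index_valid p r bp (idx l) /\
    pulls_back_to (f l) (basis_pullback p r bp a b (idx l))}.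
  apply: (@choice _ _ (fun l ix => basis_index_valid p r bp ix /\
    pulls_back_to (f l) (basis_pullback p r bp a b ix))) => l.
  by have [ix ? ?] := Phi_basis (proj1 (f_Phi l)); exists ix.
have Omega_param (z : Omega F) : exists S x y, [/\ 0 <= x <= 1, 0 <= y <= 1 &
    val z = F S (x, y)].
  case: z => z /=; rewrite inE => -[][[x y] [/= x01 y01] <-];
  by [exists Lside, x, y; rewrite !in_itv in x01 y01
     |exists Rside, x, y; rewrite !in_itv in x01 y01].
(* The patches cover [Omega F], so functions with equal labels are equal. *)
have idx_inj : injective idx.
  move=> l l' ll'; apply: f_inj; apply/funext => z.
  have [S [x [y [x01 y01 zE]]]] := Omega_param z.
  have sq : unit_square (x, y) by split; rewrite /= in_itv.
  by rewrite (proj2 (idx_f l) _ _ _ _ sq zE) (proj2 (idx_f l') _ _ _ _ sq zE) ll'.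
(* By contraposition: if [c i] were nonzero, [f i] would vanish at every point of [U]. *)
have [_ f_neq0] := f_Phi i; apply/eqP/negPn/negP => c_neq0; apply: f_neq0.
move=> z Uz; apply/eqP/negPn/negP => fz_neq0; move/negP: c_neq0; apply; apply/eqP.
have [S [x [y [x01 y01 zE]]]] := Omega_param z.
have sq : unit_square (x, y) by split; rewrite /= in_itv.
case: oU => V oV VU.
have Vz : V (F S (x, y)) by move: Uz; rewrite -VU /= -zE.
(* The box comes from the level 0 knots of the geometry; the knots of level [ell] enter through
   [corner_coef_eq0], which shrinks it further. *)
have [e e_gt0 e_V] := spline_map_corner
  (sub_path (fun u v => @ltW _ _ u v) tau_path) (tpg_spline geom S) x01 y01 oV Vz.
apply: (@corner_coef_eq0 _ p r m bp a b idx c S x y e) => //.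
- by lia.
- by lia.
- by apply: size_breakpoints_gt0; rewrite size_tuple.
- exact: breakpoints_path.
- by move=> l; case: (idx_f l).
- move=> w w01; have := gd_sign gluing w01.
  by case: S {zE Vz e_V}; apply: contraTneq => ->; rewrite ?mul0r ?mulr0 ltxx.
- move=> h h' h_e h'_e; have [sq' Vz'] := e_V h h' h_e h'_e.
  have in_Omega : F S (x + inward x * h, y + inward y * h') \in Omega F.
    by rewrite inE; case: S {zE Vz e_V} Vz' => _; [left|right];
      exists (x + inward x * h, y + inward y * h').
  pose z' : Omega F := exist (fun u => u \in Omega F) _ in_Omega.
  rewrite -[RHS](sum0 z'); last by rewrite -VU.
  apply: eq_bigr => l _; congr (_ * _); symmetry.
  exact: (proj2 (idx_f l)).
- by rewrite -(proj2 (idx_f i) _ _ _ _ sq zE).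
Qed.
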